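(* Let $\mathbb{F}$ be a field of characteristic zero. Suppose that $\big(g(x),F(x)\big)$ is an involution in the Riordan group $\mathcal{R}(\mathbb{F})$, where $g(x)$ is non-constant, and suppose that $h(x) = g(x^q)$ for some positive odd integer $q$. Let $K(x) = k_1x + k_2x^2+\cdots$ ($k_1\neq 0$) be the unique series in $\mathbb{F}[[x]]$ such that $\big(h(x),K(x)\big)$ is an involution in $\mathcal{R}(\mathbb{F})$ (such a series exists and is unique). Then $$K(x) = \big(F(x^q)\big)^{1/q}.$$
   Context: The Riordan group $\mathcal{R}(\mathbb{F})$ consists of the pairs $\big(g(x),F(x)\big)$ of formal power series over $\mathbb{F}$ with $g(x) = g_0 + g_1x + \cdots$, $g_0 \neq 0$, and $F(x) = f_1x + f_2x^2 + \cdots$, $f_1 \neq 0$ (identified with the infinite lower triangular matrix whose $(m,n)$ entry, $m,n\ge 0$, is the coefficient of $x^m$ in $g(x)F(x)^n$). Multiplication is $\big(g(x),F(x)\big)\cdot\big(h(x),K(x)\big) = \big(g(x)\cdot h(F(x)),\, K(F(x))\big)$, and the identity is $(1,x)$. An involution is an element of order exactly two; so $(g,F)\neq(1,x)$ is an involution iff $g(x)\cdot g(F(x)) = 1$ and $F(F(x)) = x$. When $(g,F)$ is an involution with $g$ non-constant one has $F(x) = -x + \cdots$. Root notation: for $a(x)$ with constant term $1$, $a(x)^{1/q}$ is the unique series with constant term $1$ whose $q$-th power is $a(x)$. For $q$ odd and $\epsilon\in\{1,-1\}$, if $a(x) = \epsilon\, x^q\,(1 + c_1x + c_2x^2 + \cdots)$,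 then $\big(a(x)\big)^{1/q} = \epsilon\, x\,(1 + c_1x + c_2x^2+\cdots)^{1/q}$. Thus $\big(F(x^q)\big)^{1/q}$ is the unique series of the form $-x + \cdots$ whose $q$-th power is $F(x^q)$. *)

(* Defs.v *)
From HB Require Import structures.
From mathcomp Require Import all_boot all_algebra.
From mathcomp Require Import boolp classical_sets.

Set Implicit Arguments.
Unset Strict Implicit.
Unset Printing Implicit Defensive.

Import GRing.Theory.
Local Open Scope ring_scope.

Record fps (R : Type) := Fps { coefs :> nat -> R }.

HB.instance Definition _ (R : Type) := gen_eqMixin (fps R).
HB.instance Definition _ (R : Type) := gen_choiceMixin (fps R).

Lemma fpsP (R : Type) (f g : fps R) : (forall n, f n = g n) <-> f = g.
Proof.
split=> [|-> //]; case: f g => [f] [g] /= fg.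
by congr Fps; apply/funext.
Qed.

Section FpsRing.
Variable R : comNzRingType.
Implicit Types f g h : fps R.

Definition fpsC (c : R) : fps R := Fps (fun n => if n == 0%N then c else 0).
Definition fpsX : fps R := Fps (fun n => (n == 1%N)%:R).
Definition fps_add f g : fps R := Fps (fun n => f n + g n).
Definition fps_opp f : fps R := Fps (fun n => - f n).
Definition fps_mul f g : fps R :=
  Fps (fun n => \sum_(i < n.+1) f i * g (n - i)%N).

Lemma fps_addA : associative fps_add.
Proof. by move=> f g h; apply/fpsP => n /=; rewrite addrA. Qed.

Lemma fps_addC : commutative fps_add.
Proof. by move=> f g; apply/fpsP => n /=; rewrite addrC. Qed.

Lemma fps_add0 : left_id (fpsC 0) fps_add.
Proof. by move=> f; apply/fpsP => n /=; rewrite if_same add0r. Qed.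

Lemma fps_addN : left_inverse (fpsC 0) fps_opp fps_add.
Proof. by move=> f; apply/fpsP => n /=; rewrite if_same addNr. Qed.

HB.instance Definition _ :=
  GRing.isZmodule.Build (fps R) fps_addA fps_addC fps_add0 fps_addN.

Definition fps_trunc (N : nat) f : {poly R} := \poly_(i < N.+1) f i.

Lemma coef_fps_trunc N f i : (i <= N)%N -> (fps_trunc N f)`_i = f i.
Proof. by move=> iN; rewrite coef_poly ltnS iN. Qed.

Lemma fps_mulE N f g n :
  (n <= N)%N -> fps_mul f g n = (fps_trunc N f * fps_trunc N g)`_n.
Proof.
move=> nN; rewrite coefM; apply: eq_bigr => i _.
have iN : (i <= N)%N by apply: leq_trans nN; rewrite -ltnS.
by rewrite !coef_fps_trunc // (leq_trans (leq_subr _ _)).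
Qed.

Lemma fps_mulA : associative fps_mul.
Proof.
move=> f g h; apply/fpsP => n.
transitivity ((fps_trunc n f * (fps_trunc n g * fps_trunc n h))`_n).
  rewrite coefM; apply: eq_bigr => i _; have := ltn_ord i; rewrite ltnS => iN.
  by rewrite coef_fps_trunc // (fps_mulE (N := n)) // leq_subr.
rewrite mulrA coefM; apply: eq_bigr => i _.
have := ltn_ord i; rewrite ltnS => iN.
by rewrite (coef_fps_trunc _ (leq_subr i n)) (fps_mulE (N := n)).
Qed.

Lemma fps_mulC : commutative fps_mul.
Proof.
by move=> f g; apply/fpsP => n; rewrite !(fps_mulE (N := n)) // mulrC.
Qed.

Lemma fps_mul1 : left_id (fpsC 1) fps_mul.
Proof.
move=> f; apply/fpsP => n /=; rewrite big_ord_recl /= mul1r subn0.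
by rewrite big1 ?addr0 // => i _; rewrite mul0r.
Qed.

Lemma fps_mulDl : left_distributive fps_mul fps_add.
Proof.
move=> f g h; apply/fpsP => n /=; rewrite -big_split.
by apply: eq_bigr => i _; rewrite mulrDl.
Qed.

Lemma fps_1neq0 : fpsC 1 != 0 :> fps R.
Proof. by apply/eqP => /fpsP /(_ 0%N) /= /eqP; rewrite oner_eq0. Qed.

HB.instance Definition _ := GRing.Zmodule_isComNzRing.Build (fps R)
  fps_mulA fps_mulC fps_mul1 fps_mulDl fps_1neq0.

(* f(g(x)), meaningful only when g has zero constant term: then g ^+ k has     *)
(* order at least k, so the powers k > n do not contribute to x^n.            *)
Definition fps_comp f g : fps R :=
  Fps (fun n => \sum_(k < n.+1) f k * (g ^+ k) n).

End FpsRing.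

Arguments fpsX {R}.

Section Riordan.
Variable F : fieldType.
Implicit Types p : fps F * fps F.

Definition riordan p : Prop :=
  [/\ p.1 0%N != 0, p.2 0%N = 0 & p.2 1%N != 0].

Definition riordan_mul p1 p2 : fps F * fps F :=
  (p1.1 * fps_comp p2.1 p1.2, fps_comp p2.2 p1.2).

Definition riordan_one : fps F * fps F := (1, fpsX).

Definition riordan_involution p : Prop :=
  [/\ riordan p, p <> riordan_one & riordan_mul p p = riordan_one].

End Riordan.

Section Roots.
Variable F : fieldType.
Implicit Types a b u : fps F.

(* The default value 0 of xget is taken when there is no such root, which     *)
(* does not happen for a series with constant term 1 in characteristic zero.  *)
Definition fps_root1 (q : nat) a : fps F :=
  xget 0 [set b : fps F | b 0%N = 1 /\ b ^+ q = a].

(* The root of a = eps x^q u with eps = 1 or -1, u = 1 + c_1 x + ... and q    *)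
(* odd, namely eps x u^(1/q); eps and u are determined by a. The value is 0   *)
(* if a is not of this form.                                                  *)
Definition fps_root (q : nat) a : fps F :=
  xget 0 [set b : fps F | exists eps u : fps F,
    [/\ eps = 1 \/ eps = -1, u 0%N = 1, a = eps * fpsX ^+ q * u
      & b = eps * fpsX * fps_root1 q u]].

End Roots.

(* Main.v *)
(* Put K = (f(x^q))^(1/q). Since K^q = f(x^q), we get h(K) = g(K^q) = g(f(x^q)),
   so h * h(K) = 1, and K(K)^q = f(K^q) = f(f(x^q)) = x^q; as K(K) = x + ..., and
   a series with constant term 1 has at most one q-th root with constant term 1,
   K(K) = x. Conversely h determines K, because h(K) = 1/h, the linear
   coefficient of K is -1, and for nonconstant h the map K |-> h(K) is injective
   on the series with a given nonzero linear coefficient. *)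

Require Import Defs.
From HB Require Import structures.
From mathcomp Require Import all_boot all_algebra.
From mathcomp Require Import boolp classical_sets.

Set Implicit Arguments.
Unset Strict Implicit.
Unset Printing Implicit Defensive.

Import GRing.Theory.
Local Open Scope ring_scope.

(** * Coefficients, orders and truncation of power series *)

Section Coefficients.
Variable R : comNzRingType.
Implicit Types f g s t : fps R.

Lemma coef_fpsD f g n : (f + g) n = f n + g n. Proof. by []. Qed.

Lemma coef_fpsN f n : (- f) n = - f n. Proof. by []. Qed.

Lemma coef_fpsM f g n : (f * g) n = \sum_(i < n.+1) f i * g (n - i)%N.
Proof. by []. Qed.

Lemma coef_fps0 n : (0 : fps R) n = 0. Proof. by case: n. Qed.

Lemma coef_fps1 n : (1 : fps R) n = (n == 0%N)%:R.
Proof. by case: n. Qed.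

Lemma coef_fps_sum (I : Type) (r : seq I) (P : pred I) (E : I -> fps R) n :
  (\sum_(i <- r | P i) E i) n = \sum_(i <- r | P i) E i n.
Proof.
by apply: (big_morph (fun f : fps R => f n)) => //; rewrite coef_fps0.
Qed.

Lemma coef_fpsCM c f n : (fpsC c * f) n = c * f n.
Proof.
rewrite coef_fpsM big_ord_recl subn0 /= big1 ?addr0 // => i _.
by rewrite mul0r.
Qed.

Lemma coef_fpsXM f n : (fpsX * f) n.+1 = f n.
Proof.
rewrite coef_fpsM !big_ord_recl /= mul0r add0r mul1r subSS subn0.
by rewrite big1 ?addr0 // => i _; rewrite mul0r.
Qed.

Lemma coef_fpsXn k n : (fpsX ^+ k : fps R) n = (n == k)%:R.
Proof.
elim: k n => [|k IH] [|n].
- by rewrite expr0 coef_fps1.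
- by rewrite expr0 coef_fps1.
- by rewrite exprS coef_fpsM big_ord1 mul0r.
- by rewrite exprS coef_fpsXM IH.
Qed.

Lemma coef0_fpsM f g : (f * g) 0%N = f 0%N * g 0%N.
Proof. by rewrite coef_fpsM big_ord1. Qed.

Lemma coef0_fpsXn f k : (f ^+ k) 0%N = f 0%N ^+ k.
Proof.
by elim: k => [|k IH]; rewrite ?expr0 ?coef_fps1 // !exprS coef0_fpsM IH.
Qed.

(** In degree [a + b] every term of the convolution except [f a * g b] has a factor below its order
    bound. The leading-term computations below rest on this; neither [f a] nor [g b] is assumed
    nonzero. *)
Lemma coef_fpsM_low f g a b :
  (forall i, (i < a)%N -> f i = 0) -> (forall i, (i < b)%N -> g i = 0) ->
  (forall i, (i < a + b)%N -> (f * g) i = 0) /\ (f * g) (a + b)%N = f a * g b.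
Proof.
move=> fa gb; split=> [n nab|].
  rewrite coef_fpsM big1 // => i _.
  have [/fa->|ai] := ltnP i a; first by rewrite mul0r.
  rewrite gb ?mulr0 // ltn_subLR; last by rewrite -ltnS.
  by rewrite (leq_trans nab) ?leq_add2r.
have lt_a : (a < (a + b).+1)%N by rewrite ltnS leq_addr.
rewrite coef_fpsM (bigD1 (Ordinal lt_a)) //= addKn big1 ?addr0 // => i.
rewrite -val_eqE /= => ia.
have [/fa->|ai] := ltnP i a; first by rewrite mul0r.
rewrite gb ?mulr0 // ltn_subLR; last by rewrite -ltnS.
by rewrite ltn_add2r ltn_neqAle eq_sym ia.
Qed.

Lemma coef_fpsX_low s k : s 0%N = 0 ->
  (forall i, (i < k)%N -> (s ^+ k) i = 0) /\ (s ^+ k) k = s 1%N ^+ k.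
Proof.
move=> s0; elim: k => [|k [IHl IHk]]; first by rewrite !expr0 coef_fps1.
have s_low i : (i < 1)%N -> s i = 0 by case: i.
have [] := coef_fpsM_low s_low IHl.
by rewrite add1n -!exprS IHk -exprS => lo ->.
Qed.

Lemma eq_coef_fpsM f f' g g' n :
  (forall i, (i <= n)%N -> f i = f' i) -> (forall i, (i <= n)%N -> g i = g' i) ->
  forall i, (i <= n)%N -> (f * g) i = (f' * g') i.
Proof.
move=> ff gg i le_in; rewrite !coef_fpsM; apply: eq_bigr => j _.
by rewrite ff ?gg // (leq_trans _ le_in) // ?leq_subr // -ltnS.
Qed.

Lemma eq_coef_fpsXn f g n k :
  (forall i, (i <= n)%N -> f i = g i) ->
  forall i, (i <= n)%N -> (f ^+ k) i = (g ^+ k) i.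
Proof.
by move=> fg; elim: k => [//|k IH]; rewrite !exprS; apply: eq_coef_fpsM.
Qed.

Lemma fps_divX f : f 0%N = 0 -> f = fpsX * Fps (fun n => f n.+1).
Proof.
move=> f0; apply/fpsP => -[|n]; last by rewrite coef_fpsXM.
by rewrite coef0_fpsM mul0r.
Qed.

Lemma fps_order f : f <> 0 ->
  exists2 m, f m != 0 & forall i, (i < m)%N -> f i = 0.
Proof.
move=> f_n0; have ex_m : exists m, f m != 0.
  apply: contra_notP f_n0 => /forallNP f0; apply/fpsP => n.
  by rewrite coef_fps0; apply/eqP/negP => /negP /f0.
case: (ex_minnP ex_m) => m fm lo; exists m => // i im.
by apply: contraTeq im => /lo; rewrite -leqNgt.
Qed.

Lemma fps_nonconst_order g : (forall c, g <> fpsC c) ->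
  exists m, [/\ (0 < m)%N, g m != 0 & forall i, (0 < i < m)%N -> g i = 0].
Proof.
move=> gC; have /fps_order[m gm glo] : g - fpsC (g 0%N) <> 0.
  by move/eqP; rewrite subr_eq0 => /eqP /gC.
have sub i : (0 < i)%N -> (g - fpsC (g 0%N)) i = g i.
  by case: i => // i _; rewrite coef_fpsD coef_fpsN /= subr0.
have m0 : (0 < m)%N.
  by case: m gm {glo} => //; rewrite coef_fpsD coef_fpsN /= subrr eqxx.
exists m; split=> //; first by rewrite -sub.
by move=> i /andP[i0 im]; rewrite -sub // glo.
Qed.

End Coefficients.

(** * Composition: a ring morphism in the outer series, and associative *)

Section Composition.
Variable R : comNzRingType.
Implicit Types f g s t : fps R.

(** With [fpsC] a ring morphism, [map_poly] lets a polynomial over [R] be evaluated at a series. *)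
Fact fpsC_is_zmod_morphism : zmod_morphism (@fpsC R).
Proof. by move=> a b; apply/fpsP => -[|n] //=; rewrite subr0. Qed.

Fact fpsC_is_monoid_morphism : monoid_morphism (@fpsC R).
Proof.
split=> // a b; apply/fpsP => n; rewrite coef_fpsCM.
by case: n => //= n; rewrite mulr0.
Qed.

HB.instance Definition _ :=
  GRing.isZmodMorphism.Build R (fps R) (@fpsC R) fpsC_is_zmod_morphism.
HB.instance Definition _ :=
  GRing.isMonoidMorphism.Build R (fps R) (@fpsC R) fpsC_is_monoid_morphism.

(** The added terms vanish because [s ^+ k] has order at least [k]. A bound independent of [n]
    allows sums from different degrees to be compared. *)
Lemma coef_fps_comp f s N n : s 0%N = 0 -> (n <= N)%N ->
  fps_comp f s n = \sum_(k < N.+1) f k * (s ^+ k) n.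
Proof.
move=> s0 nN; rewrite /fps_comp /=.
rewrite -!(big_mkord predT (fun k => f k * (s ^+ k) n)).
rewrite (big_cat_nat (n := n.+1) (p := N.+1)) //= [X in _ + X]big_nat_cond.
rewrite [X in _ + X]big1 ?addr0 // => k /andP[/andP[nk _] _].
by rewrite (coef_fpsX_low k s0).1 ?mulr0.
Qed.

Lemma eq_coef_fps_comp f g s n : (forall i, (i <= n)%N -> f i = g i) ->
  forall i, (i <= n)%N -> fps_comp f s i = fps_comp g s i.
Proof.
move=> fg i le_in /=; apply: eq_bigr => k _; rewrite fg //.
by rewrite (leq_trans _ le_in) // -ltnS.
Qed.

Lemma coef0_fps_comp f s : fps_comp f s 0%N = f 0%N.
Proof. by rewrite /= big_ord1 expr0 coef_fps1 mulr1. Qed.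

Lemma fps_compC c s : fps_comp (fpsC c) s = fpsC c.
Proof.
apply/fpsP => n /=; rewrite big_ord_recl expr0 coef_fps1 /= big1.
  by rewrite addr0; case: n => //= [|n]; rewrite ?mulr1 ?mulr0.
by move=> i _; rewrite mul0r.
Qed.

Lemma fps_comp1 s : fps_comp 1 s = 1. Proof. exact: fps_compC. Qed.

Lemma fps_compX s : s 0%N = 0 -> fps_comp fpsX s = s.
Proof.
move=> s0; apply/fpsP => n; rewrite (coef_fps_comp _ s0 (leqnSn n)).
rewrite !big_ord_recl /= mul0r add0r mul1r expr1.
by rewrite big1 ?addr0 // => i _; rewrite mul0r.
Qed.

Lemma fps_compD f g s : fps_comp (f + g) s = fps_comp f s + fps_comp g s.
Proof.
by apply/fpsP => n /=; rewrite -big_split; apply: eq_bigr => k _; rewrite mulrDl.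
Qed.

Lemma fps_compN f s : fps_comp (- f) s = - fps_comp f s.
Proof.
by apply/fpsP => n /=; rewrite -sumrN; apply: eq_bigr => k _; rewrite mulNr.
Qed.

Lemma fps_comp_sum (I : Type) (r : seq I) (P : pred I) (E : I -> fps R) s :
  fps_comp (\sum_(i <- r | P i) E i) s = \sum_(i <- r | P i) fps_comp (E i) s.
Proof.
apply: (big_morph (fun f => fps_comp f s)) => [f g|]; first exact: fps_compD.
exact: fps_compC.
Qed.

Lemma fps_comp_poly (p : {poly R}) s : s 0%N = 0 ->
  fps_comp (Fps (fun i => p`_i)) s = (map_poly (@fpsC R) p).[s].
Proof.
move=> s0; apply/fpsP => n.
(* The bound [n + size p] covers both the degree [n] and all the coefficients of [p]. *)
rewrite (coef_fps_comp _ s0 (leq_addr (size p) n)).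
have szp : (size (map_poly (@fpsC R) p) <= (n + size p).+1)%N.
  by rewrite (leq_trans (size_poly _ _)) // ltnW // ltnS leq_addl.
rewrite (horner_coef_wide _ szp) coef_fps_sum; apply: eq_bigr => k _.
by rewrite coef_map coef_fpsCM.
Qed.

(** Coefficient [n] of either side depends only on [f] and [g] up to degree [n], so both can be
    truncated to polynomials, whose evaluation at [s] is multiplicative. *)
Lemma fps_compM f g s : s 0%N = 0 ->
  fps_comp (f * g) s = fps_comp f s * fps_comp g s.
Proof.
move=> s0; apply/fpsP => n.
pose p := fps_trunc n f; pose r := fps_trunc n g.
have tr (u : fps R) i : (i <= n)%N -> u i = Fps (fun i => (fps_trunc n u)`_i) i.
  by move=> /= le_in; rewrite coef_fps_trunc.
transitivity (fps_comp (Fps (fun i => (p * r)`_i)) s n).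
  apply: (eq_coef_fps_comp s (n := n)) => // i le_in /=.
  by rewrite -fps_mulE.
rewrite fps_comp_poly // rmorphM hornerM -!fps_comp_poly //.
by apply: (@eq_coef_fpsM _ _ _ _ _ n) => // i le_in;
  apply: (eq_coef_fps_comp s (n := n)) => // j le_jn; exact/esym/tr.
Qed.

Lemma fps_compXn f s k : s 0%N = 0 -> fps_comp (f ^+ k) s = fps_comp f s ^+ k.
Proof.
move=> s0; elim: k => [|k IH]; first by rewrite !expr0 fps_comp1.
by rewrite !exprS fps_compM // IH.
Qed.

Lemma fps_compA f s t : s 0%N = 0 -> t 0%N = 0 ->
  fps_comp (fps_comp f s) t = fps_comp f (fps_comp s t).
Proof.
move=> s0 t0; apply/fpsP => n.
have st0 : fps_comp s t 0%N = 0 by rewrite coef0_fps_comp.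
(* A finite sum agreeing with [fps_comp f s] up to degree [n], to which additivity and
   multiplicativity of composition apply. *)
pose S := \sum_(k < n.+1) fpsC (f k) * s ^+ k.
transitivity (fps_comp S t n).
  apply: (eq_coef_fps_comp t (n := n)) => // i le_in.
  rewrite (coef_fps_comp f s0 le_in) coef_fps_sum.
  by apply: eq_bigr => k _; rewrite coef_fpsCM.
rewrite fps_comp_sum coef_fps_sum (coef_fps_comp f st0 (leqnn n)).
by apply: eq_bigr => k _; rewrite fps_compM // fps_compC fps_compXn // coef_fpsCM.
Qed.

Lemma coef_fps_comp_Xn g q k : (0 < q)%N ->
  fps_comp g (fpsX ^+ q) (q * k)%N = g k.
Proof.
move=> q0; have kq : (k < (q * k).+1)%N by rewrite ltnS leq_pmull.
rewrite /= (bigD1 (Ordinal kq)) //= -exprM coef_fpsXn eqxx mulr1.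
rewrite big1 ?addr0 // => i; rewrite -val_eqE /= => ik.
by rewrite -exprM coef_fpsXn eqn_pmul2l // eq_sym (negPf ik) mulr0.
Qed.

End Composition.

(** * Series over a field; uniqueness of the involution with a given nonconstant first component *)

Section Field.
Variable F : fieldType.
Implicit Types (f g h K a b : fps F).

(** The lowest nonzero coefficients of two nonzero series multiply to a nonzero coefficient. *)
Lemma fps_mulf_eq0 f g : f * g = 0 -> g <> 0 -> f = 0.
Proof.
move=> fg0 /fps_order[b gb glo]; apply: contrapT => /fps_order[a fa flo].
have [_] := coef_fpsM_low flo glo; rewrite fg0 coef_fps0 => /esym/eqP.
by rewrite mulf_eq0 (negPf fa) (negPf gb).
Qed.

Lemma riordan_involutionP g f : riordan_involution (g, f) ->
  [/\ g 0%N != 0, f 0%N = 0, f 1%N != 0, g * fps_comp g f = 1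
    & fps_comp f f = fpsX].
Proof.
case=> -[/= g0 f0 f1] _ gf; split=> //; first exact: (congr1 fst gf).
exact: (congr1 snd gf).
Qed.

Section CharZero.
Hypothesis charF0 : [pchar F] =i pred0.

Lemma natf_neq0 n : (0 < n)%N -> n%:R != 0 :> F.
Proof. by move/pcharf0P: charF0 => ->; rewrite lt0n. Qed.

(* At the lowest positive degree m in which g does not vanish, the equation
   g * g(f) = 1 reads g_0 g_m (f_1^m + 1) = 0, which excludes f_1 = 1. *)
Lemma riordan_involution_coef1 g f : riordan_involution (g, f) ->
  (forall c, g <> fpsC c) -> f 1%N = -1.
Proof.
move=> /riordan_involutionP[g0 f0 _ gf ff] /fps_nonconst_order[m [m0 gm glo]].
have : f 1%N ^+ 2 == 1.
  have /fpsP/(_ 1%N) := ff.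
  rewrite /= !big_ord_recl big_ord0 /= f0 mul0r add0r addr0 expr1 => /eqP.
  by rewrite expr2.
rewrite sqrf_eq1 => /orP[/eqP f1|/eqP //].
(* Under [f 1 = 1], the series [g] and g(f) agree up to degree [m]. *)
have comp_lo i : (i <= m)%N -> fps_comp g f i = if i == m then g m else
    if i == 0%N then g 0%N else 0.
  case: eqP => [->|/eqP im] le_im; last case: eqP => [->|/eqP i0].
  - rewrite /= big_ord_recr /= (coef_fpsX_low m f0).2 f1 expr1n mulr1.
    rewrite big1 ?add0r // => k _; have [k0|k0] := posnP k.
      by rewrite k0 expr0 coef_fps1 (gtn_eqF m0) mulr0.
    by rewrite glo ?mul0r // k0 ltn_ord.
  - by rewrite coef0_fps_comp.
  rewrite /= big1 // => k _; have [k0|k0] := posnP k.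
    by rewrite k0 expr0 coef_fps1 (negPf i0) mulr0.
  by rewrite glo ?mul0r // k0 (leq_trans (ltn_ord k)) // ltn_neqAle im.
move: (fps_comp g f) gf comp_lo => u gu comp_lo.
have /fpsP/(_ m) := gu.
rewrite coef_fpsM coef_fps1 (gtn_eqF m0).
case: m m0 gm glo comp_lo => // m _ gm glo u_lo.
rewrite big_ord_recr big_ord_recl big1 => [|i _]; last first.
  by rewrite glo ?mul0r //= /bump /= add1n ltnS ltn_ord.
rewrite /= subn0 subnn !u_lo // eqxx /= addr0 mulrC -mulr2n mulr0n -mulr_natl.
by move/eqP; rewrite !mulf_eq0 (negPf gm) (negPf g0) (negPf (natf_neq0 _)).
Qed.

(* If K and K' first differ in degree j, then h(K) and h(K') differ in degree
   j + m - 1, where m is the lowest positive degree of h: the difference there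
   is m h_m K_1^(m-1) (K_j - K'_j). *)
Lemma fps_comp_inj h K K' : (forall c, h <> fpsC c) ->
  K 0%N = 0 -> K' 0%N = 0 -> K 1%N = K' 1%N -> K 1%N != 0 ->
  fps_comp h K = fps_comp h K' -> K = K'.
Proof.
move=> /fps_nonconst_order[m [m0 hm hlo]] K0 K'0 KK' K1 hK.
apply/eqP; rewrite -subr_eq0; apply/eqP; apply: contrapT.
move=> /fps_order[j Dj Dlo].
(* The cofactor of [K - K'] in [K ^+ k - K' ^+ k]. Each of its [k] terms starts in degree [k.-1]
   with the same coefficient, as [K] and [K'] share their linear coefficient. *)
pose S k := \sum_(i < k) K ^+ (k.-1 - i) * K' ^+ i.
have S_low k : (forall i, (i < k.-1)%N -> S k i = 0) /\
    S k k.-1 = k%:R * K 1%N ^+ k.-1.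
  have step (i : 'I_k) : (forall n, (n < k.-1)%N ->
      (K ^+ (k.-1 - i) * K' ^+ i) n = 0) /\
      (K ^+ (k.-1 - i) * K' ^+ i) k.-1 = K 1%N ^+ k.-1.
    have le_ik : (i <= k.-1)%N by case: k i => [[]//|k] i; rewrite -ltnS.
    have [lo e] := coef_fpsX_low (k.-1 - i) K0.
    have [lo' e'] := coef_fpsX_low i K'0.
    by have := coef_fpsM_low lo lo'; rewrite (subnK le_ik) e e' KK' -exprD (subnK le_ik).
  split=> [i lt_ik|]; rewrite coef_fps_sum.
    by rewrite big1 // => l _; rewrite (step l).1.
  rewrite (eq_bigr (fun=> K 1%N ^+ k.-1)) => [|l _]; last by rewrite (step l).2.
  by rewrite sumr_const card_ord mulr_natl.
have KX k : K ^+ k - K' ^+ k = (K - K') * S k by exact: subrXX.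
set n := (j + m.-1)%N.
have : fps_comp h K n - fps_comp h K' n = 0 by rewrite hK subrr.
rewrite (coef_fps_comp h K0 (leq_addr m n)).
rewrite (coef_fps_comp h K'0 (leq_addr m n)) -sumrB.
have m_lt : (m < (n + m).+1)%N by rewrite ltnS leq_addl.
rewrite (bigD1 (Ordinal m_lt)) //= big1 => [|k]; last first.
  rewrite -val_eqE /= => km.
  rewrite -mulrBr -coef_fpsN -coef_fpsD KX.
  have [lo _] := coef_fpsM_low Dlo (S_low k).1.
  (* The case [k = 0] stands apart: [h 0] need not vanish, but [S 0] is an empty sum. *)
  have [k0|k0] := posnP k; first by rewrite k0 /S big_ord0 mulr0 coef_fps0 mulr0.
  have [mk|le_km] := ltnP m k.
    by rewrite lo ?mulr0 // ltn_add2l -ltnS !prednK.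
  by rewrite hlo ?mul0r // k0 ltn_neqAle km.
rewrite addr0 -mulrBr -coef_fpsN -coef_fpsD KX.
have [_ ->] := coef_fpsM_low Dlo (S_low m).1.
rewrite (S_low m).2 => /eqP.
by rewrite !mulf_eq0 (negPf hm) (negPf Dj) (negPf (natf_neq0 m0)) expf_eq0
  (negPf K1) andbF.
Qed.

Lemma riordan_involution_uniq h K K' : (forall c, h <> fpsC c) ->
  riordan_involution (h, K) -> riordan_involution (h, K') -> K = K'.
Proof.
move=> hC hK hK'.
have [h0 K0 K1 hhK _] := riordan_involutionP hK.
have [_ K'0 _ hhK' _] := riordan_involutionP hK'.
apply: (fps_comp_inj hC K0 K'0 _ K1).
  by rewrite (riordan_involution_coef1 hK) // (riordan_involution_coef1 hK').
(* Both h(K) and h(K') are the multiplicative inverse of [h]. *)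
by rewrite -[LHS]mul1r -hhK' mulrAC hhK mul1r.
Qed.

(** * Roots of power series in characteristic zero *)

Lemma fps_root1_unity q a : (0 < q)%N -> a 0%N = 1 -> a ^+ q = 1 -> a = 1.
Proof.
move=> q0 a0 aq; apply/eqP; rewrite -subr_eq0; apply/eqP.
have : a ^+ q - 1 = 0 by rewrite aq subrr.
(* The cofactor of [a - 1] in [a ^+ q - 1] has constant term [q], hence is nonzero. *)
rewrite subrX1 => /fps_mulf_eq0; apply=> /fpsP/(_ 0%N) /eqP.
rewrite coef_fps_sum (eq_bigr (fun=> 1)) => [|i _]; last first.
  by rewrite coef0_fpsXn a0 expr1n.
by rewrite sumr_const card_ord coef_fps0 (negPf (natf_neq0 q0)).
Qed.

(** The root is built one coefficient at a time: for [b] with constant term 1 and [n > 0], adding c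
    x^n to [b] changes [b ^+ q] by q c x^n modulo x^(n+1), which dictates the quotient by [q]. *)
Fixpoint fps_root_approx (q : nat) a (n : nat) : fps F :=
  if n is n'.+1 then
    let b := fps_root_approx q a n' in
    b + fpsC ((a n - (b ^+ q) n) / q%:R) * fpsX ^+ n
  else 1.

Lemma fps_root_approxS q a n : let b := fps_root_approx q a n in
  fps_root_approx q a n.+1 =
    b + fpsC ((a n.+1 - (b ^+ q) n.+1) / q%:R) * fpsX ^+ n.+1.
Proof. by []. Qed.

Lemma coef_fps_root_approx q a n m i : (i <= n <= m)%N ->
  fps_root_approx q a m i = fps_root_approx q a n i.
Proof.
case/andP=> le_in; elim: m => [|m IH]; first by rewrite leqn0 => /eqP->.
rewrite leq_eqVlt => /orP[/eqP->//|]; rewrite ltnS => le_nm.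
rewrite fps_root_approxS coef_fpsD coef_fpsCM coef_fpsXn ltn_eqF ?mulr0 ?addr0 ?IH //.
by rewrite ltnS (leq_trans le_in).
Qed.

Lemma fps_root_approxP q a n : (0 < q)%N -> a 0%N = 1 ->
  forall i, (i <= n)%N -> (fps_root_approx q a n ^+ q) i = a i.
Proof.
move=> q0 a0; elim: n => [|n IH] i.
  by rewrite leqn0 => /eqP->; rewrite expr1n coef_fps1 a0.
set b := fps_root_approx q a n.
have b0 : b 0%N = 1 by rewrite (@coef_fps_root_approx q a 0) // coef_fps1.
pose d := fpsC ((a n.+1 - (b ^+ q) n.+1) / q%:R) * fpsX ^+ n.+1.
have dE k : d k = (a n.+1 - (b ^+ q) n.+1) / q%:R * (k == n.+1)%:R.
  by rewrite coef_fpsCM coef_fpsXn.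
have -> : fps_root_approx q a n.+1 = b + d by [].
(* Here [d * S] is the change in the power. It starts in degree [n.+1], where only the constant term
   [q] of [S] matters. *)
pose S := \sum_(k < q) (b + d) ^+ (q.-1 - k) * b ^+ k.
have -> : (b + d) ^+ q = b ^+ q + d * S.
  by rewrite -[LHS](subrK (b ^+ q)) addrC subrXX addrAC subrr add0r.
have d_lo k : (k < n.+1)%N -> d k = 0 by move=> kn; rewrite dE ltn_eqF // mulr0.
have S_lo k : (k < 0)%N -> S k = 0 by [].
have [lo hi] := coef_fpsM_low d_lo S_lo.
rewrite addn0 in lo hi; rewrite leq_eqVlt => /orP[/eqP->|lt_in]; last first.
  by rewrite coef_fpsD lo // addr0 IH.
rewrite coef_fpsD hi dE eqxx mulr1.
have -> : S 0%N = q%:R.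
  rewrite coef_fps_sum (eq_bigr (fun=> 1)) ?sumr_const ?card_ord // => k _.
  by rewrite coef0_fpsM !coef0_fpsXn coef_fpsD b0 d_lo // addr0 !expr1n mulr1.
by rewrite divfK ?natf_neq0 // addrC subrK.
Qed.

Lemma fps_root1P q a : (0 < q)%N -> a 0%N = 1 ->
  fps_root1 q a 0%N = 1 /\ fps_root1 q a ^+ q = a.
Proof.
move=> q0 a0; apply: (@xgetPex _ 0 [set b : fps F | b 0%N = 1 /\ b ^+ q = a]).
(* The diagonal is the limit, since coefficient [n] is fixed from approximation [n] on. *)
pose b := Fps (fun n => fps_root_approx q a n n).
exists b; split=> //; apply/fpsP => n.
rewrite -(fps_root_approxP q0 a0 (leqnn n)).
apply: (@eq_coef_fpsXn _ _ _ n) => // i le_in /=.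
by rewrite (@coef_fps_root_approx q a i n i) // leqnn.
Qed.

(** The hypotheses show that the default value of [xget] is not taken. The decomposition it selects
    is not compared with [eps] and [u], so the linear coefficient is given only up to sign, which
    suffices for K(K) = x. *)
Lemma fps_root_spec q a (eps u : fps F) : odd q -> eps = 1 \/ eps = -1 ->
  u 0%N = 1 -> a = eps * fpsX ^+ q * u ->
  [/\ fps_root q a 0%N = 0, fps_root q a 1%N ^+ 2 = 1
    & fps_root q a ^+ q = a].
Proof.
move=> q_odd eps1 u0 aE; set b := fps_root q a.
have q0 : (0 < q)%N by case: q q_odd {aE b}.
have [e [v [e1 v0 -> ->]]] : exists eps u : fps F,
    [/\ eps = 1 \/ eps = -1, u 0%N = 1, a = eps * fpsX ^+ q * u
      & b = eps * fpsX * fps_root1 q u].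
  apply: (@xgetPex _ 0 [set b : fps F | exists eps u : fps F,
    [/\ eps = 1 \/ eps = -1, u 0%N = 1, a = eps * fpsX ^+ q * u
      & b = eps * fpsX * fps_root1 q u]]).
  by exists (eps * fpsX * fps_root1 q u), eps, u.
have [w0 wq] := fps_root1P q0 v0; split.
- by rewrite !coef0_fpsM mulr0 mul0r.
- rewrite (mulrC e) -mulrA coef_fpsXM coef0_fpsM w0 mulr1 -coef0_fpsXn.
  by case: e1 => ->; rewrite ?sqrrN expr1n.
rewrite !exprMn wq; congr (_ * _ * _).
by case: e1 => ->; rewrite ?expr1n // -signr_odd q_odd expr1.
Qed.

(** Writing K = x w gives K(K) = x w w(K). The factor w w(K) has constant term [K 1 ^+ 2 = 1], and
    its [q]-th power is 1 once x^q is cancelled. *)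
Lemma fps_comp_self_root q K : (0 < q)%N -> K 0%N = 0 -> K 1%N ^+ 2 = 1 ->
  fps_comp K K ^+ q = fpsX ^+ q -> fps_comp K K = fpsX.
Proof.
move=> q0 K0 K1; have KX := fps_divX K0; set w := Fps _ in KX.
have -> : fps_comp K K = fpsX * (w * fps_comp w K).
  by rewrite {1}KX fps_compM // fps_compX // {1}KX mulrA.
rewrite exprMn => /eqP; rewrite -subr_eq0 -{2}[fpsX ^+ q]mulr1 -mulrBr mulrC.
move=> /eqP /fps_mulf_eq0 t1.
rewrite (@fps_root1_unity q (w * fps_comp w K)) ?mulr1 //.
  by rewrite coef0_fpsM coef0_fps_comp.
apply/eqP; rewrite -subr_eq0; apply/eqP/t1 => /fpsP/(_ q)/eqP.
by rewrite coef_fpsXn eqxx coef_fps0 oner_eq0.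
Qed.

End CharZero.
End Field.

Theorem theorem3p5 (F : fieldType) (charF0 : [pchar F] =i pred0)
    (g f h : fps F) (q : nat)
    (gf_inv : riordan_involution (g, f))
    (g_nonconst : forall c : F, g <> fpsC c)
    (q_odd : odd q)
    (h_def : h = fps_comp g (fpsX ^+ q)) :
  (exists! K : fps F, riordan_involution (h, K)) /\
  (forall K : fps F, riordan_involution (h, K) ->
     K = fps_root q (fps_comp f (fpsX ^+ q))).
Proof.
have q0 : (0 < q)%N by case: q q_odd {h_def}.
have [g0 f0 _ gf ff] := riordan_involutionP gf_inv.
have f1 := riordan_involution_coef1 charF0 gf_inv g_nonconst.
have h_nonconst c : h <> fpsC c.
  (* A nonzero coefficient of [g] in degree [m > 0] reappears in [h] in degree [q * m > 0]. *)
  move=> hc; have [m [m0 gm _]] := fps_nonconst_order g_nonconst.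
  move: gm; rewrite -(coef_fps_comp_Xn g m q0) -h_def hc /=.
  by rewrite muln_eq0 !gtn_eqF // eqxx.
set s : fps F := fpsX ^+ q; set K := fps_root q _.
have s0 : s 0%N = 0 by rewrite coef_fpsXn (ltn_eqF q0).
(* Since [f 1 = -1], the series v = -f/x has constant term 1, and f(x^q) = -x^q v(x^q) has the shape
   required for a root, with sign -1. *)
pose v : fps F := - Fps (fun n => f n.+1).
have sE : fps_comp f s = -1 * s * fps_comp v s.
  rewrite (fps_divX f0) fps_compM // fps_compX // fps_compN.
  by rewrite mulN1r mulNr mulrN opprK.
have v0 : fps_comp v s 0%N = 1 by rewrite coef0_fps_comp coef_fpsN /= f1 opprK.
have [K0 K1 Kq] := fps_root_spec charF0 q_odd (or_intror erefl) v0 sE.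
rewrite -/K in K0 K1 Kq.
(* Both sides equal [K ^+ q]. With associativity, this moves [K] past x^q and turns it into [f] in
   both components. *)
have sK : fps_comp s K = fps_comp f s by rewrite fps_compXn // fps_compX.
have fs0 : fps_comp f s 0%N = 0 by rewrite coef0_fps_comp.
have K_inv : riordan_involution (h, K).
  split.
  - split; [|exact: K0|].
      by rewrite [h]h_def coef0_fps_comp.
    by rewrite -sqrf_eq0 K1 oner_neq0.
  - by case=> h1 _; apply: (h_nonconst 1).
  congr (_, _) => /=.
    rewrite {2}h_def (fps_compA _ s0 K0) sK -(fps_compA _ f0 s0) h_def.
    by rewrite -(fps_compM _ _ s0) gf fps_comp1.
  apply: (fps_comp_self_root charF0 q0 K0 K1).
  rewrite -(fps_compXn _ _ K0) Kq (fps_compA _ s0 K0) sK -(fps_compA _ f0 s0) ff.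
  exact: fps_compX.
have K_uniq K' : riordan_involution (h, K') -> K' = K.
  by move=> K'_inv; apply: (riordan_involution_uniq charF0 h_nonconst).
split=> //; exists K; split=> // K' K'_inv; exact/esym/K_uniq.
Qed.
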